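(* Let there be given the function $\varphi(x)=\frac23\sin x+\frac13\tan x=\sum_{k=0}^{\infty}a_kx^{2k+1}:\left(0,\frac{\pi}{2}\right)\to\mathbb{R}$, with coefficients $$a_k=\frac{2(-1)^k}{3(2k+1)!}+\frac{2^{2k+2}(2^{2k+2}-1)|\mathbf{B}_{2k+2}|}{3(2k+2)!}\qquad(k\in\mathbb{N}_0).$$ Let $c\in\left(0,\frac{\pi}{2}\right)$ be fixed. Then for $x\in(0,c)$ it holds: $$\begin{array}{c}T_0^{\varphi,0+}(x)-x<\ldots<T_n^{\varphi,0+}(x)-x<T_{n+1}^{\varphi,0+}(x)-x<\ldots\\[1ex] \ldots<\frac23\sin x+\frac13\tan x-x<\ldots\\[1ex] \ldots<\mathbb{T}_{n+1}^{\varphi;0+,c-}(x)-x<\mathbb{T}_n^{\varphi;0+,c-}(x)-x<\ldots<\mathbb{T}_0^{\varphi;0+,c-}(x)-x.\end{array}$$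
   Context: $\mathbf{B}_k$ denotes the $k$-th Bernoulli number and $\mathbb{N}_0=\{0,1,2,\ldots\}$. For $n\in\mathbb{N}_0$, the first Taylor approximation of $\varphi$ in the right neighbourhood of $0$ is the Taylor polynomial of order $n$, $$T_n^{\varphi,0+}(x)=\sum_{k=0}^n\frac{\varphi^{(k)}(0+)}{k!}x^k,\qquad \varphi^{(k)}(0+)=\lim_{x\to0+}\varphi^{(k)}(x).$$ The second Taylor approximation of $\varphi$ in the right neighbourhood of $0$, on the interval $(0,c)$, is $$\mathbb{T}_n^{\varphi;0+,c-}(x)=T_{n-1}^{\varphi,0+}(x)+\frac{\varphi(c-)-T_{n-1}^{\varphi,0+}(c)}{c^n}\,x^n\quad(n\ge1),\qquad \mathbb{T}_0^{\varphi;0+,c-}(x)=\varphi(c-),$$ where $\varphi(c-)=\lim_{x\to c-}\varphi(x)=\varphi(c)$. The function $Q(x)=\frac23\sin x+\frac13\tan x-x$ being estimated is the error of the Huygens approximation $x\approx\frac23\sin x+\frac13\tan x$.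
   Formalization: The strict chain T_n − x < T_{n+1} − x fails as printed (φ is odd and a_1 = 0, so T_1 = T_2 = T_3 = T_4); instead it is proved that T_n − x ≤ T_{n+1} − x for all n, with strict inequality exactly when n+1 is odd and n+1 ≠ 3. *)

(* Defs.v *)
From Stdlib Require Import Reals Lra Lia Arith.
From Coquelicot Require Import Coquelicot.
Open Scope R_scope.

(* Like [RInt], these are total operators obtained from [iota]: they return the
   limit whenever it exists (see [right_lim_unique] and [left_lim_unique]). *)
Definition right_lim (f : R -> R) (a : R) : R :=
  iota (fun l => filterlim f (at_right a) (locally l)).

Definition left_lim (f : R -> R) (b : R) : R :=
  iota (fun l => filterlim f (at_left b) (locally l)).

Lemma right_lim_unique (f : R -> R) (a l : R) :
  filterlim f (at_right a) (locally l) -> right_lim f a = l.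
Proof.
intros H. apply (iota_unique (V := R_CompleteNormedModule)); [|exact H].
intros y Hy. exact (filterlim_locally_unique f y l Hy H).
Qed.

Lemma left_lim_unique (f : R -> R) (b l : R) :
  filterlim f (at_left b) (locally l) -> left_lim f b = l.
Proof.
intros H. apply (iota_unique (V := R_CompleteNormedModule)); [|exact H].
intros y Hy. exact (filterlim_locally_unique f y l Hy H).
Qed.

(* First Taylor approximation of order n in the right neighbourhood of 0;
   [sum_f_R0 _ n] has the n + 1 terms k = 0, ..., n. *)
Definition taylor1 (f : R -> R) (n : nat) (x : R) : R :=
  sum_f_R0 (fun k => right_lim (Derive_n f k) 0 / INR (fact k) * x ^ k) n.

(* Second Taylor approximation of order n in the right neighbourhood of 0,
   on the interval (0, c). *)
Definition taylor2 (f : R -> R) (c : R) (n : nat) (x : R) : R :=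
  match n with
  | O => left_lim f c
  | S m => taylor1 f m x + (left_lim f c - taylor1 f m c) / c ^ n * x ^ n
  end.

(* [bernoulli_upto n k] is the k-th Bernoulli number for k <= n; the last branch
   is B_(m+1) = - 1/(m+2) * sum_(j <= m) binom(m+2, j) B_j. *)
Fixpoint bernoulli_upto (n : nat) : nat -> R :=
  match n with
  | O => fun _ => 1
  | S m => fun k =>
      if (k <=? m)%nat then bernoulli_upto m k
      else - sum_f_R0 (fun j => Binomial.C (S (S m)) j * bernoulli_upto m j) m
           / INR (S (S m))
  end.

Definition bernoulli (k : nat) : R := bernoulli_upto k k.

Lemma bernoulli_upto_eq (n k : nat) :
  (k <= n)%nat -> bernoulli_upto n k = bernoulli k.
Proof.
induction n as [|n IH]; intros Hk.
- now replace k with 0%nat by lia.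
- destruct (Nat.eq_dec k (S n)) as [->|Hne]; [reflexivity|].
  simpl. rewrite (proj2 (Nat.leb_le k n)) by lia. apply IH. lia.
Qed.

Lemma bernoulli_0 : bernoulli 0 = 1.
Proof. reflexivity. Qed.

Lemma bernoulli_rec (n : nat) :
  (1 <= n)%nat ->
  sum_f_R0 (fun j => Binomial.C (S n) j * bernoulli j) n = 0.
Proof.
destruct n as [|m]; [lia|intros _].
rewrite tech5.
rewrite (sum_eq _ (fun j => Binomial.C (S (S m)) j * bernoulli_upto m j))
  by (intros i Hi; now rewrite bernoulli_upto_eq).
assert (HC : Binomial.C (S (S m)) (S m) = INR (S (S m))).
{ rewrite pascal_step1 by lia. replace (S (S m) - S m)%nat with 1%nat by lia.
  unfold Binomial.C. replace (S (S m) - 1)%nat with (S m) by lia.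
  rewrite (fact_simpl (S m)), mult_INR. simpl (fact 1). 
  change (INR 1) with 1. field. apply INR_fact_neq_0. }
rewrite HC.
assert (HB : bernoulli (S m) =
  - sum_f_R0 (fun j => Binomial.C (S (S m)) j * bernoulli_upto m j) m
    / INR (S (S m))).
{ unfold bernoulli.
  change (bernoulli_upto (S m) (S m)) with
    (if (S m <=? m)%nat then bernoulli_upto m (S m)
     else - sum_f_R0 (fun j => Binomial.C (S (S m)) j * bernoulli_upto m j) m
           / INR (S (S m))).
  now rewrite (proj2 (Nat.leb_gt (S m) m)) by lia. }
rewrite HB. field. apply not_0_INR. lia.
Qed.

Definition huygens_coef (k : nat) : R :=
  2 * (-1) ^ k / (3 * INR (fact (2 * k + 1)))
  + 2 ^ (2 * k + 2) * (2 ^ (2 * k + 2) - 1) * Rabs (bernoulli (2 * k + 2))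
    / (3 * INR (fact (2 * k + 2))).

(* Main.v *)
Require Import Defs.
From Stdlib Require Import Reals Lra Lia Arith.
From Coquelicot Require Import Coquelicot.
Open Scope R_scope.

(** The proof rests on one fact: in
    [phi x = 2/3 * sin x + 1/3 * tan x = w_0 + w_1 * x + w_2 * x ^ 2 + ...]
    every coefficient [w_n] is nonnegative, and [w_n] is positive exactly for odd
    [n <> 3] ([phi_coef_pos], [phi_coef_3], [phi_coef_even]).

    Given this, put [rho_n x = w_n + w_(n+1) * x + ...] ([tail]). Then
    [phi x = T_(n-1) x + x ^ n * rho_n x], so the first approximations increase
    with [n] towards [phi]. The second approximation of order [n] is
    [T_(n-1) x + x ^ n * rho_n c] ([taylor2_phi_tail]): it lies above [phi]
    because [rho_n] increases strictly ([tail_lt]), and from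
    [rho_n c = w_n + c * rho_(n+1) c] the difference of two consecutive ones is
    [x ^ n * (c - x) * rho_(n+1) c > 0].

    The analytic work is the expansion of [tan] on [(0, PI / 2)] with Bernoulli
    coefficients. The recurrence of the Bernoulli numbers says that
    [B x = sum of B_n / n! * x ^ n] satisfies [B x * (exp x - 1) = x]
    ([PSeries_bernoulli_egf]), and [x * tanh x = x - B (2 * x) + B (4 * x)]
    identifies the coefficients of [tanh] near 0. Comparing coefficients in
    [tanh' = 1 - tanh ^ 2] and changing signs gives the recurrence of
    [tan' = 1 + tan ^ 2] ([tan_coef_S]), from which the coefficients of [tan]
    are nonnegative; this also settles the signs of the Bernoulli numbers.

    Convergence up to [PI / 2] comes from a comparison: a partial sum [S] of this
    nonnegative series satisfies [S' <= 1 + S ^ 2], hence [atan S <= x], hence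
    [S <= tan x] ([atan_partial_sum_le]). The sum of the series then solves
    [y' = 1 + y ^ 2], [y 0 = 0], and so equals [tan] ([PSeries_tan_coef]).

    Finally [n! * w_n = 2/3 * (+1 or -1) + 1/3 * t_n] for odd [n], where the
    tangent numbers [t_n = 1, 2, 16, ...] exceed 2 from [n = 5] on
    ([tangent_number_gt_2]); for [n = 3] the two terms cancel. *)

(** * Sums and power series *)

Lemma sum_f_R0_ge_0 (f : nat -> R) (n : nat) :
  (forall k, (k <= n)%nat -> 0 <= f k) -> 0 <= sum_f_R0 f n.
Proof.
intros H. rewrite <- (Rmult_0_l (INR (S n))), <- (sum_cte 0 n).
now apply sum_Rle.
Qed.

Lemma sum_f_R0_ge_term (f : nat -> R) (n i : nat) :
  (forall k, 0 <= f k) -> (i <= n)%nat -> f i <= sum_f_R0 f n.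
Proof.
intros Hf. induction n as [|n IH]; intros Hi.
- replace i with 0%nat by lia. simpl. lra.
- rewrite tech5. destruct (Nat.eq_dec i (S n)) as [->|Hne].
  + pose proof (sum_f_R0_ge_0 f n (fun k _ => Hf k)). lra.
  + pose proof (IH ltac:(lia)). pose proof (Hf (S n)). lra.
Qed.

Lemma CV_radius_gt (a : nat -> R) (c x : R) :
  ex_pseries a c -> Rabs x < Rabs c -> Rbar_lt (Rabs x) (CV_radius a).
Proof.
intros Hc Hx.
apply Rbar_lt_le_trans with (Rabs c); [exact Hx|].
apply Rbar_not_lt_le. intros Hout.
apply (CV_disk_outside _ _ Hout), ex_series_lim_0.
now apply ex_pseries_R.
Qed.

Lemma CV_radius_gt_Rabs (a : nat -> R) (r x : R) :
  (forall y, 0 < y < r -> ex_pseries a y) -> Rabs x < r ->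
  Rbar_lt (Rabs x) (CV_radius a).
Proof.
intros H Hx. pose proof (Rabs_pos x).
apply (CV_radius_gt _ ((Rabs x + r) / 2)).
- apply H. lra.
- rewrite (Rabs_pos_eq ((Rabs x + r) / 2)); lra.
Qed.

Definition PS_one (n : nat) : R := match n with O => 1 | S _ => 0 end.

Lemma is_pseries_one (x : R) : is_pseries PS_one x 1.
Proof.
apply is_pseries_R, is_series_Reals. intros eps Heps. exists 0%nat.
intros n _. replace (sum_f_R0 (fun i => PS_one i * x ^ i) n) with 1.
- rewrite Rdist_eq. exact Heps.
- induction n as [|n IH]; simpl in *; [ring|]. rewrite <- IH. ring.
Qed.

Lemma is_pseries_comp_scal (a : nat -> R) (q x l : R) :
  is_pseries a (q * x) l -> is_pseries (fun n => q ^ n * a n) x l.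
Proof.
intros H. apply is_pseries_R. apply is_pseries_R in H.
revert H. apply is_series_ext. intros n.
change (a n * (q * x) ^ n = q ^ n * a n * x ^ n).
rewrite Rpow_mult_distr. ring.
Qed.

(** * The generating function of the Bernoulli numbers *)

Definition bernoulli_egf (n : nat) : R := bernoulli n / INR (fact n).

(** The coefficients of [(exp x - 1) / x]. *)
Definition exp_quot (n : nat) : R := / INR (fact (S n)).

Lemma PS_mult_bernoulli_exp_quot (n : nat) :
  PS_mult bernoulli_egf exp_quot n = PS_one n.
Proof.
destruct n as [|n].
- unfold PS_mult, bernoulli_egf, exp_quot; simpl.
  rewrite bernoulli_0. field.
- assert (H := bernoulli_rec (S n) ltac:(lia)).
  apply Rmult_eq_reg_l with (INR (fact (S (S n)))); [|apply INR_fact_neq_0].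
  rewrite Rmult_0_r. rewrite <- H. unfold PS_mult. rewrite scal_sum.
  apply sum_eq. intros j Hj. unfold bernoulli_egf, exp_quot, Binomial.C.
  replace (S (S n) - j)%nat with (S (S n - j)) by lia.
  field. split; apply INR_fact_neq_0.
Qed.

Lemma bernoulli_egf_0 : bernoulli_egf 0 = 1.
Proof. unfold bernoulli_egf; simpl. rewrite bernoulli_0. field. Qed.

Lemma bernoulli_egf_1 : bernoulli_egf 1 = - / 2.
Proof.
assert (H := PS_mult_bernoulli_exp_quot 1).
unfold PS_mult, exp_quot in H. simpl in H. rewrite bernoulli_egf_0 in H. lra.
Qed.

Lemma pow2_le_fact_S (k : nat) : 2 ^ k <= INR (fact (S k)).
Proof.
induction k as [|k IH]; [simpl; lra|].
rewrite (fact_simpl (S k)), mult_INR, <- tech_pow_Rmult.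
apply Rmult_le_compat; [lra|apply pow_le; lra| |exact IH].
rewrite !S_INR. pose proof (pos_INR k). lra.
Qed.

Lemma sum_pow_half_le_1 (m : nat) :
  sum_f_R0 (fun j => (/ 2) ^ (S m - j)) m <= 1.
Proof.
induction m as [|m IH]; [simpl; lra|].
rewrite tech5. replace (S (S m) - S m)%nat with 1%nat by lia.
rewrite (sum_eq _ (fun j => (/ 2) ^ (S m - j) * / 2)).
- rewrite <- scal_sum. simpl pow at 2. lra.
- intros j Hj. replace (S (S m) - j)%nat with (S (S m - j)) by lia.
  simpl. ring.
Qed.

(** The recurrence expresses each coefficient as minus a combination of the
    preceding ones with weights [1 / (k + 1)! <= 2 ^ (- k)], [k >= 1], whose sum
    is at most 1. This crude bound serves to have a positive radius of
    convergence; the true radius is [2 * PI]. *)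
Lemma Rabs_bernoulli_egf_le_1 (n : nat) : Rabs (bernoulli_egf n) <= 1.
Proof.
induction n as [n IH] using lt_wf_ind. destruct n as [|m].
- rewrite bernoulli_egf_0, Rabs_R1. lra.
- assert (H := PS_mult_bernoulli_exp_quot (S m)).
  unfold PS_mult in H. rewrite tech5 in H. simpl PS_one in H.
  rewrite Nat.sub_diag in H.
  replace (exp_quot 0) with 1 in H by (unfold exp_quot; simpl; field).
  replace (bernoulli_egf (S m)) with
    (- sum_f_R0 (fun k => bernoulli_egf k * exp_quot (S m - k)) m) by lra.
  rewrite Rabs_Ropp. eapply Rle_trans; [apply Rsum_abs|].
  eapply Rle_trans; [|apply (sum_pow_half_le_1 m)].
  apply sum_Rle. intros k Hk. rewrite Rabs_mult.
  rewrite <- (Rmult_1_l ((/ 2) ^ _)).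
  apply Rmult_le_compat; [apply Rabs_pos|apply Rabs_pos|apply IH; lia|].
  unfold exp_quot. rewrite Rabs_pos_eq.
  + rewrite pow_inv. apply Rinv_le_contravar; [apply pow_lt; lra|].
    apply pow2_le_fact_S.
  + left. apply Rinv_0_lt_compat, INR_fact_lt_0.
Qed.

Lemma CV_radius_bernoulli_egf (x : R) :
  Rabs x < 1 -> Rbar_lt (Rabs x) (CV_radius bernoulli_egf).
Proof.
intros Hx. apply Rbar_lt_le_trans with 1; [exact Hx|].
apply (proj1 (CV_radius_bounded bernoulli_egf)). exists 1. intros n.
rewrite pow1, Rmult_1_r. apply Rabs_bernoulli_egf_le_1.
Qed.

Lemma CV_radius_exp (x : R) :
  Rbar_lt (Rabs x) (CV_radius (fun n => / INR (fact n))).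
Proof.
apply (CV_radius_gt_Rabs _ (Rabs x + 1)); [|lra].
intros y _. eexists. apply is_exp_Reals.
Qed.

Lemma PSeries_bernoulli_egf (x : R) :
  Rabs x < 1 -> PSeries bernoulli_egf x * (exp x - 1) = x.
Proof.
intros Hx.
assert (HE : Rbar_lt (Rabs x) (CV_radius exp_quot)).
{ change exp_quot with (PS_decr_1 (fun n => / INR (fact n))).
  rewrite CV_radius_decr_1. apply CV_radius_exp. }
assert (He : exp x = 1 + x * PSeries exp_quot x).
{ rewrite exp_Reals, PSeries_decr_1.
  - simpl. now rewrite Rinv_1.
  - apply CV_radius_inside, CV_radius_exp. }
rewrite He.
replace (1 + x * PSeries exp_quot x - 1) with (PSeries exp_quot x * x) by ring.
rewrite <- Rmult_assoc, <- PSeries_mult; trivial.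
- rewrite (PSeries_ext _ PS_one _ PS_mult_bernoulli_exp_quot).
  rewrite (is_pseries_unique _ _ _ (is_pseries_one x)). ring.
- now apply CV_radius_bernoulli_egf.
Qed.

(** * The power series of the hyperbolic tangent *)

(** The coefficients of [tanh], read off from
    [x * tanh x = x - B (2 * x) + B (4 * x)] with [B x = x / (exp x - 1)]. *)
Definition tanh_coef (n : nat) : R :=
  (4 ^ S n - 2 ^ S n) * bernoulli_egf (S n) + PS_one n.

Lemma is_pseries_incr_tanh_coef (x : R) :
  Rabs x < 1 / 4 ->
  is_pseries (PS_incr_1 tanh_coef) x
    (PSeries bernoulli_egf (4 * x) - PSeries bernoulli_egf (2 * x) + x).
Proof.
intros Hx.
assert (HB : forall q, 0 < q <= 4 ->
  is_pseries (fun n => q ^ n * bernoulli_egf n) x (PSeries bernoulli_egf (q * x))).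
{ intros q Hq. apply is_pseries_comp_scal, PSeries_correct, CV_radius_inside.
  apply CV_radius_bernoulli_egf. rewrite Rabs_mult, (Rabs_pos_eq q) by lra.
  pose proof (Rabs_pos x). nra. }
assert (H := is_pseries_plus _ _ _ _ _
  (is_pseries_minus _ _ _ _ _ (HB 4 ltac:(lra)) (HB 2 ltac:(lra)))
  (is_pseries_incr_1 _ _ _ (is_pseries_one x))).
replace (_ + x) with (plus (plus (PSeries bernoulli_egf (4 * x))
  (opp (PSeries bernoulli_egf (2 * x)))) (scal x 1)).
- revert H. apply is_pseries_ext. intros n.
  unfold PS_plus, PS_minus, PS_incr_1, tanh_coef, plus, opp; simpl.
  unfold PS_plus, PS_opp, plus, opp, zero; simpl.
  destruct n as [|n]; simpl; ring.
- unfold plus, opp, scal; simpl. unfold mult; simpl. ring.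
Qed.

Lemma CV_radius_tanh_coef (x : R) :
  Rabs x < 1 / 4 -> Rbar_lt (Rabs x) (CV_radius tanh_coef).
Proof.
intros Hx. rewrite <- CV_radius_incr_1.
apply (CV_radius_gt_Rabs _ (1 / 4)); [|exact Hx].
intros y Hy. eexists. apply is_pseries_incr_tanh_coef.
rewrite Rabs_pos_eq; lra.
Qed.

Lemma tanh_coef_0 : tanh_coef 0 = 0.
Proof. unfold tanh_coef. rewrite bernoulli_egf_1. simpl. field. Qed.

Lemma PSeries_tanh_coef (x : R) :
  Rabs x < 1 / 4 ->
  PSeries tanh_coef x = (exp (2 * x) - 1) / (exp (2 * x) + 1).
Proof.
intros Hx. pose proof (exp_pos (2 * x)) as Hpos.
destruct (Req_dec x 0) as [->|Hx0].
{ rewrite PSeries_0, tanh_coef_0, Rmult_0_r, exp_0. field. }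
apply Rmult_eq_reg_l with x; [|exact Hx0].
rewrite <- PSeries_incr_1.
rewrite (is_pseries_unique _ _ _ (is_pseries_incr_tanh_coef x Hx)).
assert (H2 : PSeries bernoulli_egf (2 * x) * (exp (2 * x) - 1) = 2 * x).
{ apply PSeries_bernoulli_egf. rewrite Rabs_mult, Rabs_pos_eq; lra. }
assert (H4 : PSeries bernoulli_egf (4 * x) * (exp (2 * x) * exp (2 * x) - 1) = 4 * x).
{ rewrite <- exp_plus. replace (2 * x + 2 * x) with (4 * x) by ring.
  apply PSeries_bernoulli_egf. rewrite Rabs_mult, Rabs_pos_eq; lra. }
assert (Hne : exp (2 * x) - 1 <> 0).
{ intros H0. rewrite H0 in H2. lra. }
set (e := exp (2 * x)) in *.
assert (Hne4 : e * e - 1 <> 0) by nra.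
replace (PSeries bernoulli_egf (2 * x)) with (2 * x / (e - 1))
  by (apply Rmult_eq_reg_r with (e - 1); [rewrite H2; field|]; exact Hne).
replace (PSeries bernoulli_egf (4 * x)) with (4 * x / (e * e - 1))
  by (apply Rmult_eq_reg_r with (e * e - 1); [rewrite H4; field|]; exact Hne4).
field. repeat split; trivial; lra.
Qed.

(** Two power series that agree near 0 have the same coefficients; here the two
    series are the sides of [tanh' = 1 - tanh ^ 2]. *)
Lemma tanh_coef_S (n : nat) :
  INR (S n) * tanh_coef (S n) = PS_one n - PS_mult tanh_coef tanh_coef n.
Proof.
assert (H0 : Rabs 0 < 1 / 4) by (rewrite Rabs_R0; lra).
assert (Hmult : forall x, Rabs x < 1 / 4 ->
  Rbar_lt (Rabs x) (CV_radius (PS_mult tanh_coef tanh_coef))).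
{ intros x Hx. apply (CV_radius_gt_Rabs _ (1 / 4)); [|exact Hx].
  intros y Hy. assert (Rabs y < 1 / 4) by (rewrite Rabs_pos_eq; lra).
  apply ex_pseries_mult; now apply CV_radius_tanh_coef. }
change (PS_derive tanh_coef n = PS_minus PS_one (PS_mult tanh_coef tanh_coef) n).
assert (Hminus : forall x, Rabs x < 1 / 4 ->
  ex_pseries (PS_minus PS_one (PS_mult tanh_coef tanh_coef)) x).
{ intros x Hx. apply ex_pseries_minus.
  - eexists; apply is_pseries_one.
  - apply CV_radius_inside. now apply Hmult. }
apply PSeries_ext_recip.
- rewrite CV_radius_derive, <- Rabs_R0. now apply CV_radius_tanh_coef.
- rewrite <- Rabs_R0. apply (CV_radius_gt_Rabs _ (1 / 4)); [|exact H0].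
  intros y Hy. apply Hminus. rewrite Rabs_pos_eq; lra.
- assert (Hloc : forall x, Rabs x < 1 / 4 -> locally x (fun y => Rabs y < 1 / 4)).
  { intros x Hx. assert (He : 0 < 1 / 4 - Rabs x) by lra.
    exists (mkposreal _ He). intros y Hy.
    change (Rabs (y - x) < 1 / 4 - Rabs x) in Hy.
    replace y with ((y - x) + x) by ring.
    eapply Rle_lt_trans; [apply Rabs_triang|]. lra. }
  generalize (Hloc 0 H0). apply filter_imp. intros x Hx.
  rewrite <- Derive_PSeries by now apply CV_radius_tanh_coef.
  rewrite (Derive_ext_loc _ (fun x => (exp (2 * x) - 1) / (exp (2 * x) + 1))).
  2:{ generalize (Hloc x Hx). apply filter_imp. intros y. apply PSeries_tanh_coef. }
  rewrite PSeries_minus.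
  + rewrite (is_pseries_unique _ _ _ (is_pseries_one x)).
    rewrite PSeries_mult by now apply CV_radius_tanh_coef.
    rewrite (PSeries_tanh_coef x Hx).
    pose proof (exp_pos (2 * x)).
    apply is_derive_unique. auto_derive; [lra|]. field. lra.
  + eexists; apply is_pseries_one.
  + apply CV_radius_inside. now apply Hmult.
Qed.

Lemma tanh_coef_even (n : nat) : Nat.Even n -> tanh_coef n = 0.
Proof.
induction n as [n IH] using lt_wf_ind. intros Hn. destruct n as [|m].
- apply tanh_coef_0.
- apply Rmult_eq_reg_l with (INR (S m)); [|apply not_0_INR; lia].
  rewrite tanh_coef_S, Rmult_0_r. destruct Hn as [j Hj].
  replace (PS_one m) with 0 by (destruct m; [lia|reflexivity]).
  unfold PS_mult. rewrite (sum_eq _ (fun _ => 0)).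
  + rewrite sum_cte. ring.
  + intros k Hk. destruct (Nat.Even_or_Odd k) as [Hk'|[i Hi]].
    * rewrite (IH k ltac:(lia) Hk'). ring.
    * rewrite (IH (m - k)%nat); [ring|lia|]. exists (j - i - 1)%nat. lia.
Qed.

(** * The power series of the tangent *)

(** [tan x = - i * tanh (i * x)] turns into a sign change on the odd
    coefficients. *)
Definition tan_coef (n : nat) : R := (-1) ^ Nat.div2 n * tanh_coef n.

Lemma tan_coef_even (n : nat) : Nat.Even n -> tan_coef n = 0.
Proof. intros H. unfold tan_coef. rewrite tanh_coef_even; [ring|exact H]. Qed.

(** The change of signs turns [tanh' = 1 - tanh ^ 2] into [tan' = 1 + tan ^ 2]:
    in a product of two coefficients of odd orders [2 * i + 1] and [2 * j + 1]
    the signs multiply to [(-1) ^ (i + j)], opposite to the sign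
    [(-1) ^ (i + j + 1)] of the coefficient that it contributes to. *)
Lemma tan_coef_S (n : nat) :
  INR (S n) * tan_coef (S n) = PS_one n + PS_mult tan_coef tan_coef n.
Proof.
destruct (Nat.Even_or_Odd n) as [[m Hm]|[m Hm]].
- unfold tan_coef at 1.
  replace (Nat.div2 (S n)) with m by (rewrite Hm, Nat.div2_succ_double; trivial).
  transitivity ((-1) ^ m * (INR (S n) * tanh_coef (S n))); [ring|].
  rewrite tanh_coef_S, Rmult_minus_distr_l. unfold Rminus. f_equal.
  + destruct n as [|n]; simpl; [|ring]. replace m with 0%nat by lia. simpl. ring.
  + rewrite Ropp_mult_distr_l. unfold PS_mult. rewrite scal_sum. apply sum_eq.
    intros k Hk. destruct (Nat.Even_or_Odd k) as [Hk'|[i Hi]].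
    * rewrite (tanh_coef_even k Hk'), (tan_coef_even k Hk'). ring.
    * unfold tan_coef. replace (n - k)%nat with (S (2 * (m - i - 1))) by lia.
      replace k with (S (2 * i)) by lia. rewrite !Nat.div2_succ_double.
      replace ((-1) ^ m) with ((-1) ^ (S (i + (m - i - 1)))) by (f_equal; lia).
      simpl pow. rewrite pow_add. ring.
- rewrite tan_coef_even by (exists (S m); lia).
  replace (PS_one n) with 0 by (destruct n; [lia|reflexivity]).
  unfold PS_mult. rewrite (sum_eq _ (fun _ => 0)).
  + rewrite sum_cte. ring.
  + intros k Hk. destruct (Nat.Even_or_Odd k) as [Hk'|[i Hi]].
    * rewrite (tan_coef_even k Hk'). ring.
    * rewrite (tan_coef_even (n - k)); [ring|]. exists (m - i)%nat. lia.
Qed.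

Lemma tan_coef_ge_0 (n : nat) : 0 <= tan_coef n.
Proof.
induction n as [n IH] using lt_wf_ind. destruct n as [|m].
- rewrite tan_coef_even; [lra|now exists 0%nat].
- apply Rmult_le_reg_l with (INR (S m)); [apply lt_0_INR; lia|].
  rewrite Rmult_0_r, tan_coef_S. apply Rplus_le_le_0_compat.
  + destruct m; simpl; lra.
  + apply sum_f_R0_ge_0. intros k Hk. apply Rmult_le_pos; apply IH; lia.
Qed.
Definition partial_sum (a : nat -> R) (n : nat) (x : R) : R :=
  sum_f_R0 (fun k => a k * x ^ k) n.

Lemma is_derive_partial_sum (a : nat -> R) (n : nat) (x : R) :
  is_derive (partial_sum a (S n)) x (partial_sum (PS_derive a) n x).
Proof.
unfold partial_sum. induction n as [|n IH].
- simpl. unfold PS_derive. auto_derive; [trivial|simpl; ring].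
- apply (is_derive_plus _ _ _ _ _ IH).
  unfold PS_derive. auto_derive; [trivial|].
  rewrite !S_INR. destruct n; simpl; ring.
Qed.

Lemma partial_sum_tan_coef_0 (n : nat) : partial_sum tan_coef n 0 = 0.
Proof.
unfold partial_sum. induction n as [|n IH].
- simpl. rewrite tan_coef_even by now exists 0%nat. ring.
- rewrite tech5, IH, pow_ne_zero by lia. ring.
Qed.

Lemma partial_sum_tan_coef_le (n : nat) (x : R) :
  0 <= x -> partial_sum tan_coef n x <= partial_sum tan_coef (S n) x.
Proof.
intros Hx. unfold partial_sum. rewrite tech5.
pose proof (Rmult_le_pos _ _ (tan_coef_ge_0 (S n)) (pow_le x (S n) Hx)). lra.
Qed.

Lemma partial_sum_tan_coef_ge_0 (n : nat) (x : R) :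
  0 <= x -> 0 <= partial_sum tan_coef n x.
Proof.
intros Hx. apply sum_f_R0_ge_0. intros k _.
apply Rmult_le_pos; [apply tan_coef_ge_0|now apply pow_le].
Qed.

(** The products of monomials in the truncated Cauchy square all occur in the
    square of the partial sum, whose remaining products are nonnegative. *)
Lemma partial_sum_PS_mult_le (n : nat) (x : R) :
  0 <= x ->
  partial_sum (PS_mult tan_coef tan_coef) n x <= (partial_sum tan_coef n x) ^ 2.
Proof.
intros Hx. unfold partial_sum.
destruct n as [|n].
- unfold PS_mult. simpl. lra.
- rewrite <- Rsqr_pow2. unfold Rsqr. rewrite (cauchy_finite _ _ (S n)) by lia.
  rewrite (sum_eq (fun k => PS_mult tan_coef tan_coef k * x ^ k)
    (fun k => sum_f_R0 (fun p => tan_coef p * x ^ p *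
                  (tan_coef (k - p) * x ^ (k - p))) k)).
  + rewrite <- (Rplus_0_r (sum_f_R0 _ (S n))) at 1. apply Rplus_le_compat_l.
    apply sum_f_R0_ge_0. intros k _. apply sum_f_R0_ge_0. intros l _.
    apply Rmult_le_pos; apply Rmult_le_pos;
      (apply tan_coef_ge_0 || now apply pow_le).
  + intros k _. unfold PS_mult. rewrite Rmult_comm, scal_sum. apply sum_eq.
    intros p Hp. replace (x ^ k) with (x ^ p * x ^ (k - p)).
    * ring.
    * rewrite <- pow_add. f_equal. lia.
Qed.

(** A partial sum [S] satisfies [S' <= 1 + S ^ 2], so that [atan S - x] is
    nonincreasing: the polynomial stays below the solution [tan] of
    [y' = 1 + y ^ 2], without any knowledge of the higher derivatives of [tan]. *)
Lemma atan_partial_sum_le (n : nat) (x : R) :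
  0 <= x -> atan (partial_sum tan_coef n x) <= x.
Proof.
intros Hx.
(* For a sum of positive degree [S n] the derivative is a partial sum of degree
   [n], to be compared with the square of the sum of degree [n]. *)
apply Rle_trans with (atan (partial_sum tan_coef (S n) x)).
{ destruct (partial_sum_tan_coef_le n x Hx) as [Hlt|Heq].
  - left. now apply atan_increasing.
  - rewrite Heq. lra. }
destruct (Req_dec x 0) as [->|Hx0].
{ rewrite partial_sum_tan_coef_0, atan_0. lra. }
pose (p := partial_sum tan_coef (S n)).
pose (p' := partial_sum (PS_derive tan_coef) n).
destruct (MVT_cor2 (fun y => atan (p y) - y)
  (fun y => p' y * / (1 + (p y) ^ 2) - 1) 0 x) as [y [Hy Hy0]]; [lra| |].
- intros y _. apply is_derive_Reals.
  apply (is_derive_minus (fun y => atan (p y)) (fun y => y)).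
  + apply (is_derive_comp atan p).
    * apply is_derive_Reals, derivable_pt_lim_atan.
    * apply is_derive_partial_sum.
  + apply (is_derive_id (K := R_AbsRing)).
- assert (Hp : p' y <= 1 + (p y) ^ 2).
  { unfold p', p, partial_sum.
    rewrite (sum_eq _ (fun k => PS_one k * y ^ k
                         + PS_mult tan_coef tan_coef k * y ^ k)).
    2:{ intros k _. unfold PS_derive. rewrite tan_coef_S. ring. }
    rewrite sum_plus. apply Rplus_le_compat.
    - right. clear. induction n as [|n IH]; simpl in *; [ring|]. rewrite IH. ring.
    - eapply Rle_trans; [apply partial_sum_PS_mult_le; lra|].
      apply pow_incr. split; [apply partial_sum_tan_coef_ge_0; lra|].
      apply partial_sum_tan_coef_le. lra. }
  unfold p at 2 in Hy. rewrite partial_sum_tan_coef_0, atan_0 in Hy.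
  assert (Hq : p' y * / (1 + (p y) ^ 2) <= 1).
  { pose proof (pow2_ge_0 (p y)).
    apply Rmult_le_reg_r with (1 + p y ^ 2); [lra|].
    rewrite Rmult_assoc, Rinv_l; lra. }
  fold p. nra.
Qed.

Lemma ex_pseries_tan_coef (x : R) : 0 < x < PI / 2 -> ex_pseries tan_coef x.
Proof.
intros Hx. apply ex_pseries_R.
assert (Hsum : forall n, sum_n (fun k => tan_coef k * x ^ k) n
                         = partial_sum tan_coef n x)
  by (intros n; apply sum_n_Reals).
destruct (ex_finite_lim_seq_incr (sum_n (fun k => tan_coef k * x ^ k)) (tan x))
  as [l Hl].
- intros n. rewrite !Hsum. apply partial_sum_tan_coef_le. lra.
- intros n. rewrite Hsum. pose proof (atan_partial_sum_le n x ltac:(lra)) as H.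
  rewrite <- (tan_atan (partial_sum tan_coef n x)).
  pose proof (atan_bound (partial_sum tan_coef n x)).
  destruct H as [H| ->]; [|lra]. left. apply tan_increasing; lra.
- now exists l.
Qed.

Lemma CV_radius_tan_coef (x : R) :
  Rabs x < PI / 2 -> Rbar_lt (Rabs x) (CV_radius tan_coef).
Proof. apply CV_radius_gt_Rabs. exact ex_pseries_tan_coef. Qed.

(** Since [y = PSeries tan_coef] solves [y' = 1 + y ^ 2], [y 0 = 0], the function
    [atan y - x] is constant. *)
Lemma PSeries_tan_coef (x : R) : 0 < x < PI / 2 -> PSeries tan_coef x = tan x.
Proof.
intros Hx.
rewrite <- (tan_atan (PSeries tan_coef x)). f_equal.
destruct (MVT_cor2 (fun y => atan (PSeries tan_coef y) - y) (fun y => 0) 0 x)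
  as [y [Hy _]]; [lra| |].
- intros y Hy. apply is_derive_Reals.
  assert (Hy' : Rabs y < PI / 2) by (rewrite Rabs_pos_eq; lra).
  assert (HC := CV_radius_tan_coef y Hy').
  replace 0 with (PSeries (PS_derive tan_coef) y
                  * / (1 + (PSeries tan_coef y) ^ 2) - 1).
  + apply (is_derive_minus (fun y => atan (PSeries tan_coef y)) (fun y => y)).
    * apply (is_derive_comp atan (PSeries tan_coef)).
      -- apply is_derive_Reals, derivable_pt_lim_atan.
      -- now apply is_derive_PSeries.
    * apply (is_derive_id (K := R_AbsRing)).
  + rewrite (PSeries_ext _ (PS_plus PS_one (PS_mult tan_coef tan_coef))).
    2:{ intros n. apply tan_coef_S. }
    rewrite PSeries_plus.
    * rewrite (is_pseries_unique _ _ _ (is_pseries_one y)).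
      rewrite PSeries_mult by exact HC.
      pose proof (pow2_ge_0 (PSeries tan_coef y)). field. lra.
    * eexists; apply is_pseries_one.
    * now apply ex_pseries_mult.
- rewrite PSeries_0, (tan_coef_even 0), atan_0 in Hy by now exists 0%nat.
  lra.
Qed.

Lemma tan_coef_odd_bernoulli (k : nat) :
  tan_coef (2 * k + 1) =
  2 ^ (2 * k + 2) * (2 ^ (2 * k + 2) - 1) * Rabs (bernoulli (2 * k + 2))
    / INR (fact (2 * k + 2)).
Proof.
(* The sign of the Bernoulli number is known only through the sign of the
   tangent coefficient. *)
rewrite <- (Rabs_pos_eq _ (tan_coef_ge_0 (2 * k + 1))).
unfold tan_coef, tanh_coef, bernoulli_egf.
rewrite Rabs_mult, pow_1_abs, Rmult_1_l.
replace (S (2 * k + 1)) with (2 * k + 2)%nat by lia.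
replace (PS_one (2 * k + 1)) with 0 by (now rewrite Nat.add_1_r).
rewrite Rplus_0_r.
replace (4 ^ (2 * k + 2)) with (2 ^ (2 * k + 2) * 2 ^ (2 * k + 2))
  by (rewrite <- Rpow_mult_distr; f_equal; ring).
pose proof (pow_R1_Rle 2 (2 * k + 2) ltac:(lra)).
rewrite Rabs_mult, Rabs_div by apply INR_fact_neq_0.
rewrite (Rabs_pos_eq (INR _)) by apply pos_INR.
rewrite Rabs_pos_eq by nra. field. apply INR_fact_neq_0.
Qed.

Lemma tan_coef_1 : tan_coef 1 = 1.
Proof.
assert (H := tan_coef_S 0). unfold PS_mult in H. simpl in H.
rewrite (tan_coef_even 0) in H by now exists 0%nat. lra.
Qed.

Lemma tan_coef_3 : tan_coef 3 = 1 / 3.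
Proof.
assert (H := tan_coef_S 2). unfold PS_mult in H. simpl in H.
rewrite (tan_coef_even 0) in H by now exists 0%nat.
rewrite (tan_coef_even 2), tan_coef_1 in H by now exists 1%nat. lra.
Qed.

(** The two products in the recurrence that contain [tan_coef 1 = 1] already make
    the tangent numbers [tan_coef n * n!] grow by a factor [2 * (2 * k + 2)] at
    least, of which the proof keeps 4. *)
Lemma tangent_number_S (k : nat) :
  (1 <= k)%nat ->
  4 * (tan_coef (2 * k + 1) * INR (fact (2 * k + 1)))
  <= tan_coef (2 * S k + 1) * INR (fact (2 * S k + 1)).
Proof.
intros Hk.
assert (Hrec : 2 * tan_coef (2 * k + 1) <= INR (2 * k + 3) * tan_coef (2 * k + 3)).
{ replace (2 * k + 3)%nat with (S (S (S (2 * k)))) by lia.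
  rewrite tan_coef_S. simpl PS_one. rewrite Rplus_0_l.
  unfold PS_mult. rewrite !tech5, Nat.sub_diag.
  replace (S (S (2 * k)) - S (2 * k))%nat with 1%nat by lia.
  rewrite (tan_coef_even 0), tan_coef_1 by now exists 0%nat.
  assert (H := sum_f_R0_ge_term
    (fun j => tan_coef j * tan_coef (S (S (2 * k)) - j)) (2 * k) 1
    (fun j => Rmult_le_pos _ _ (tan_coef_ge_0 _) (tan_coef_ge_0 _)) ltac:(lia)).
  cbv beta in H. replace (S (S (2 * k)) - 1)%nat with (S (2 * k)) in H by lia.
  rewrite tan_coef_1 in H. rewrite Nat.add_1_r. lra. }
replace (2 * S k + 1)%nat with (S (S (2 * k + 1))) by lia.
rewrite (fact_simpl (S _)), (fact_simpl (2 * k + 1)), !mult_INR.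
replace (S (S (2 * k + 1))) with (2 * k + 3)%nat by lia.
replace (S (2 * k + 1)) with (2 * k + 2)%nat by lia.
assert (H2 : 2 <= INR (2 * k + 2)) by (apply (le_INR 2); lia).
pose proof (INR_fact_lt_0 (2 * k + 1)) as Hf.
pose proof (tan_coef_ge_0 (2 * k + 1)).
apply Rle_trans with (2 * tan_coef (2 * k + 1) * (INR (2 * k + 2) * INR (fact (2 * k + 1)))).
- assert (0 <= tan_coef (2 * k + 1) * INR (fact (2 * k + 1)))
    by (apply Rmult_le_pos; lra). nra.
- rewrite <- (Rmult_assoc (tan_coef (2 * k + 3))), (Rmult_comm (tan_coef (2 * k + 3))).
  apply Rmult_le_compat_r; [apply Rmult_le_pos; lra|exact Hrec].
Qed.

Lemma tangent_number_gt_2 (k : nat) :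
  (2 <= k)%nat -> 2 < tan_coef (2 * k + 1) * INR (fact (2 * k + 1)).
Proof.
intros Hk. destruct k as [|[|k]]; [lia|lia|]. clear Hk.
assert (Hge : 2 <= tan_coef (2 * S k + 1) * INR (fact (2 * S k + 1))).
{ induction k as [|k IH].
  - simpl. rewrite tan_coef_3. lra.
  - eapply Rle_trans; [|apply tangent_number_S; lia]. lra. }
eapply Rlt_le_trans; [|apply tangent_number_S; lia]. lra.
Qed.

(** * The power series of the Huygens function *)

(** The zeros at the even orders allow a sum with [tan_coef]. *)
Definition sin_coef (n : nat) : R :=
  if Nat.odd n then (-1) ^ Nat.div2 n / INR (fact n) else 0.

Lemma is_pseries_sin (x : R) : is_pseries sin_coef x (sin x).
Proof.
unfold sin. destruct (exist_sin (Rsqr x)) as [l Hl].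
replace (x * l) with (0 + x * l) by ring.
apply is_pseries_odd_even.
- apply (is_pseries_ext (fun _ => 0)).
  + intros n. unfold sin_coef. now rewrite Nat.odd_even.
  + apply is_pseries_R, (is_series_ext (fun _ => 0)).
    * intros n. change (0 = 0 * (x ^ 2) ^ n). ring.
    * apply is_series_Reals. intros eps Heps. exists 0%nat. intros n _.
      rewrite sum_cte, Rmult_0_l, Rdist_eq. exact Heps.
- apply is_pseries_R, is_series_Reals. rewrite <- Rsqr_pow2.
  apply is_series_Reals. apply is_series_Reals in Hl. revert Hl.
  apply is_series_ext. intros n. unfold sin_coef, sin_n.
  rewrite Nat.odd_odd. now rewrite Nat.add_1_r, Nat.div2_succ_double.
Qed.

Definition phi_coef : nat -> R :=
  PS_plus (PS_scal (2 / 3) sin_coef) (PS_scal (1 / 3) tan_coef).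

Lemma is_pseries_phi (x : R) :
  0 < x < PI / 2 ->
  is_pseries phi_coef x (2 / 3 * sin x + 1 / 3 * tan x).
Proof.
intros Hx.
apply (is_pseries_plus (PS_scal (2 / 3) sin_coef) (PS_scal (1 / 3) tan_coef)).
- apply (is_pseries_scal (2 / 3) sin_coef); [apply Rmult_comm|].
  apply is_pseries_sin.
- apply (is_pseries_scal (1 / 3) tan_coef); [apply Rmult_comm|].
  rewrite <- PSeries_tan_coef by exact Hx.
  now apply PSeries_correct, ex_pseries_tan_coef.
Qed.

Lemma phi_coef_even (n : nat) : Nat.Even n -> phi_coef n = 0.
Proof.
intros Hn.
change (phi_coef n) with (2 / 3 * sin_coef n + 1 / 3 * tan_coef n).
rewrite tan_coef_even by exact Hn. unfold sin_coef.
destruct Hn as [m ->]. rewrite Nat.odd_even. ring.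
Qed.

Lemma phi_coef_odd (k : nat) :
  phi_coef (2 * k + 1) =
  2 / 3 * ((-1) ^ k / INR (fact (2 * k + 1))) + 1 / 3 * tan_coef (2 * k + 1).
Proof.
change (phi_coef (2 * k + 1)) with
  (2 / 3 * sin_coef (2 * k + 1) + 1 / 3 * tan_coef (2 * k + 1)).
unfold sin_coef. rewrite Nat.odd_odd.
replace (Nat.div2 (2 * k + 1)) with k
  by (now rewrite Nat.add_1_r, Nat.div2_succ_double).
reflexivity.
Qed.

Lemma phi_coef_odd_huygens (k : nat) : phi_coef (2 * k + 1) = huygens_coef k.
Proof.
rewrite phi_coef_odd, tan_coef_odd_bernoulli. unfold huygens_coef.
field. split; apply INR_fact_neq_0.
Qed.

Lemma phi_coef_3 : phi_coef 3 = 0.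
Proof.
change (phi_coef (2 * 1 + 1) = 0). rewrite phi_coef_odd.
change (2 * 1 + 1)%nat with 3%nat. rewrite tan_coef_3. simpl. field.
Qed.

(** In [n! * phi_coef n] with [n >= 5], the sine contributes at least [- 2/3], and
    the tangent more than [2/3]. *)
Lemma phi_coef_pos (n : nat) : Nat.Odd n -> n <> 3%nat -> 0 < phi_coef n.
Proof.
intros [k ->] Hn. rewrite phi_coef_odd.
destruct (Nat.le_gt_cases 2 k) as [Hk|Hk].
- apply Rmult_lt_reg_r with (INR (fact (2 * k + 1))); [apply INR_fact_lt_0|].
  pose proof (tangent_number_gt_2 k Hk) as Ht.
  pose proof (INR_fact_neq_0 (2 * k + 1)).
  assert (Hs : -1 <= (-1) ^ k).
  { pose proof (Rabs_maj2 ((-1) ^ k)). rewrite pow_1_abs in *. lra. }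
  replace ((_ + _) * _) with (2 / 3 * (-1) ^ k
    + 1 / 3 * (tan_coef (2 * k + 1) * INR (fact (2 * k + 1)))) by now field.
  lra.
- assert (k = 0%nat) as -> by lia.
  change (2 * 0 + 1)%nat with 1%nat. rewrite tan_coef_1. simpl. lra.
Qed.

Lemma phi_coef_ge_0 (n : nat) : 0 <= phi_coef n.
Proof.
destruct (Nat.Even_or_Odd n) as [Hn|Hn].
- rewrite phi_coef_even by exact Hn. lra.
- destruct (Nat.eq_dec n 3) as [->|Hne].
  + rewrite phi_coef_3. lra.
  + left. now apply phi_coef_pos.
Qed.

Lemma CV_radius_phi (x : R) :
  Rabs x < PI / 2 -> Rbar_lt (Rabs x) (CV_radius phi_coef).
Proof.
apply CV_radius_gt_Rabs. intros y Hy. eexists. now apply is_pseries_phi.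
Qed.

(** Deleting the vanishing even terms keeps the sum: the partial sums of the new
    series form a subsequence of the old ones. *)
Lemma is_series_odd_terms (a : nat -> R) (l : R) :
  (forall k, a (2 * k)%nat = 0) -> is_series a l ->
  is_series (fun k => a (2 * k + 1)%nat) l.
Proof.
intros Ha Hl.
assert (Hsub : is_lim_seq (fun k => sum_n a (2 * k + 1)) l).
{ apply is_lim_seq_subseq with (u := sum_n a); [|exact Hl].
  apply eventually_subseq. intros n. lia. }
revert Hsub. apply is_lim_seq_ext. intros n. rewrite !sum_n_Reals.
induction n as [|n IH].
- simpl. specialize (Ha 0%nat). simpl in Ha. rewrite Ha. ring.
- rewrite (tech5 _ n), <- IH.
  replace (2 * S n + 1)%nat with (S (S (2 * n + 1))) by lia.
  rewrite !tech5. replace (S (2 * n + 1)) with (2 * S n)%nat by lia.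
  rewrite Ha. ring.
Qed.

Lemma is_series_huygens_coef (x : R) :
  0 < x < PI / 2 ->
  is_series (fun k => huygens_coef k * x ^ (2 * k + 1))
    (2 / 3 * sin x + 1 / 3 * tan x).
Proof.
intros Hx.
apply (is_series_ext (fun k => phi_coef (2 * k + 1) * x ^ (2 * k + 1))).
- intros k. now rewrite phi_coef_odd_huygens.
- apply (is_series_odd_terms (fun n => phi_coef n * x ^ n)).
  + intros k. rewrite phi_coef_even by now exists k. apply Rmult_0_l.
  + now apply is_pseries_R, is_pseries_phi.
Qed.

(** * Tails of power series with nonnegative coefficients *)

(** The remainder of the series divided by the power [x ^ n] in front of it: the
    quotient still has nonnegative coefficients, so it is monotone in [x]. *)
Definition tail (a : nat -> R) (n : nat) (x : R) : R := PSeries (PS_decr_n a n) x.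

Section Tails.

Variable a : nat -> R.
Variable r : R.
Hypothesis a_ge_0 : forall n, 0 <= a n.
Hypothesis a_pos : forall n, exists m, (n <= m)%nat /\ 0 < a m.
Hypothesis a_cv : forall x, 0 < x < r -> ex_pseries a x.

Lemma ex_series_tail (n : nat) (x : R) :
  0 < x < r -> ex_series (fun k => a (n + k)%nat * x ^ k).
Proof.
intros Hx. apply ex_pseries_R, (ex_pseries_decr_n (V := R_NormedModule)).
- right. exists (/ x). apply Rinv_l. lra.
- now apply a_cv.
Qed.

Lemma tail_S (n : nat) (x : R) :
  0 < x < r -> tail a n x = a n + x * tail a (S n) x.
Proof.
intros Hx. unfold tail. rewrite PSeries_decr_1.
- f_equal; [|f_equal].
  + unfold PS_decr_n. f_equal. lia.
  + apply PSeries_ext. intros k. unfold PS_decr_1, PS_decr_n. f_equal. lia.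
- now apply ex_pseries_R, ex_series_tail.
Qed.

Lemma tail_ge_0 (n : nat) (x : R) : 0 < x < r -> 0 <= tail a n x.
Proof.
intros Hx. rewrite <- (PSeries_const_0 x). unfold tail, PSeries.
apply Series_le; [|now apply ex_series_tail].
intros k. rewrite Rmult_0_l. split; [lra|].
apply Rmult_le_pos; [apply a_ge_0|apply pow_le; lra].
Qed.

(** A positive coefficient of some order [m >= n] makes the tail of order [m]
    positive, and the recurrence carries this down to the order [n]. *)
Lemma tail_pos (n : nat) (x : R) : 0 < x < r -> 0 < tail a n x.
Proof.
intros Hx. destruct (a_pos n) as [m [Hm Ham]].
replace n with (m - (m - n))%nat by lia.
assert (Hle : (m - n <= m)%nat) by lia. revert Hle.
generalize (m - n)%nat as i. induction i as [|i IH]; intros Hi.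
- rewrite Nat.sub_0_r, tail_S by exact Hx.
  pose proof (tail_ge_0 (S m) x Hx). nra.
- rewrite tail_S by exact Hx.
  replace (S (m - S i)) with (m - i)%nat by lia.
  pose proof (a_ge_0 (m - S i)). specialize (IH ltac:(lia)).
  pose proof (Rmult_lt_0_compat x _ ltac:(lra) IH). lra.
Qed.

Lemma tail_le (n : nat) (x y : R) :
  0 < x < y -> y < r -> tail a n x <= tail a n y.
Proof.
intros Hx Hy. unfold tail, PSeries.
apply Series_le; [|apply ex_series_tail; lra]. intros k. split.
- apply Rmult_le_pos; [apply a_ge_0|apply pow_le; lra].
- apply Rmult_le_compat_l; [apply a_ge_0|apply pow_incr; lra].
Qed.

Lemma tail_lt (n : nat) (x y : R) :
  0 < x < y -> y < r -> tail a n x < tail a n y.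
Proof.
intros Hx Hy. rewrite (tail_S n x), (tail_S n y) by lra.
pose proof (tail_le (S n) x y Hx Hy). pose proof (tail_pos (S n) x ltac:(lra)).
nra.
Qed.

Lemma PSeries_partial_sum_tail (n : nat) (x : R) :
  0 < x < r -> PSeries a x = partial_sum a n x + x ^ S n * tail a (S n) x.
Proof. intros Hx. now apply PSeries_decr_n, a_cv. Qed.

End Tails.

(** * The Taylor approximations *)

(** All the derivatives extend continuously to 0 because the function agrees on
    the right of 0 with the sum of a power series, which is smooth around 0. *)
Lemma right_lim_Derive_n_PSeries (f : R -> R) (a : nat -> R) (r : R) (k : nat) :
  0 < r -> Rbar_lt 0 (CV_radius a) ->
  (forall x, 0 < x < r -> f x = PSeries a x) ->
  right_lim (Derive_n f k) 0 = a k * INR (fact k).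
Proof.
intros Hr Ha Hf. apply right_lim_unique. rewrite <- Derive_n_coef by exact Ha.
apply (filterlim_ext_loc (Derive_n (PSeries a) k)).
- exists (mkposreal _ Hr). intros x Hx Hx0.
  change (Rabs (x - 0) < r) in Hx. rewrite Rminus_0_r in Hx.
  rewrite Rabs_pos_eq in Hx by lra.
  apply Derive_n_ext_loc.
  generalize (open_and _ _ (open_gt 0) (open_lt r) x (conj Hx0 Hx)).
  apply filter_imp. intros y Hy. now rewrite Hf.
- apply (filterlim_filter_le_1 (G := at_right 0) (F := locally 0)).
  + apply filter_le_within.
  + apply (ex_derive_continuous (V := R_NormedModule) (Derive_n (PSeries a) k) 0).
    apply (ex_derive_n_PSeries (S k)). now rewrite Rabs_R0.
Qed.

Section Huygens.

Variable phi : R -> R.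
Hypothesis Hphi : forall x, 0 < x < PI / 2 -> phi x = 2 / 3 * sin x + 1 / 3 * tan x.

Lemma phi_PSeries (x : R) : 0 < x < PI / 2 -> phi x = PSeries phi_coef x.
Proof.
intros Hx. rewrite Hphi by exact Hx. symmetry.
now apply is_pseries_unique, is_pseries_phi.
Qed.

Lemma taylor1_phi (n : nat) (x : R) : taylor1 phi n x = partial_sum phi_coef n x.
Proof.
unfold taylor1, partial_sum. apply sum_eq. intros k _.
rewrite (right_lim_Derive_n_PSeries phi phi_coef (PI / 2)).
- field. apply INR_fact_neq_0.
- apply PI2_RGT_0.
- rewrite <- Rabs_R0. apply CV_radius_phi. rewrite Rabs_R0. apply PI2_RGT_0.
- exact phi_PSeries.
Qed.

Lemma left_lim_phi (c : R) : 0 < c < PI / 2 -> left_lim phi c = PSeries phi_coef c.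
Proof.
intros Hc. apply left_lim_unique.
apply (filterlim_filter_le_1 (G := at_left c) (F := locally c)).
{ apply filter_le_within. }
apply (filterlim_ext_loc (PSeries phi_coef)).
- generalize (open_and _ _ (open_gt 0) (open_lt (PI / 2)) c Hc).
  apply filter_imp. intros y Hy. now rewrite phi_PSeries.
- apply (continuity_pt_filterlim (PSeries phi_coef) c), PSeries_continuity.
  apply CV_radius_phi. rewrite Rabs_pos_eq; lra.
Qed.

Lemma phi_coef_infinitely_pos (n : nat) : exists m, (n <= m)%nat /\ 0 < phi_coef m.
Proof.
exists (2 * (n + 2) + 1)%nat. split; [lia|].
apply phi_coef_pos; [now exists (n + 2)%nat|lia].
Qed.

Lemma ex_pseries_phi (x : R) : 0 < x < PI / 2 -> ex_pseries phi_coef x.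
Proof. intros Hx. eexists. now apply is_pseries_phi. Qed.

(** The second approximation of order [n] is [phi] with the argument of the tail
    frozen at [c]: the coefficient [(phi (c-) - T_(n-1) c) / c ^ n] is the tail
    at [c], while the polynomial part is the same. *)
Lemma taylor2_phi_tail (c x : R) (n : nat) :
  0 < c < PI / 2 -> 0 < x < PI / 2 ->
  taylor2 phi c n x =
  PSeries phi_coef x + x ^ n * (tail phi_coef n c - tail phi_coef n x).
Proof.
intros Hc Hx. destruct n as [|n].
- change (left_lim phi c = PSeries phi_coef x
    + 1 * (PSeries phi_coef c - PSeries phi_coef x)).
  rewrite left_lim_phi by exact Hc. ring.
- unfold taylor2. rewrite left_lim_phi, !taylor1_phi by exact Hc.
  rewrite (PSeries_partial_sum_tail _ _ ex_pseries_phi n c Hc).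
  rewrite (PSeries_partial_sum_tail _ _ ex_pseries_phi n x Hx).
  assert (c ^ S n <> 0) by (apply pow_nonzero; lra). field. exact H.
Qed.

End Huygens.

Theorem theorem7 (phi : R -> R)
  (Hphi : forall x : R, 0 < x < PI / 2 -> phi x = 2 / 3 * sin x + 1 / 3 * tan x) :
  (forall x : R, 0 < x < PI / 2 ->
     is_series (fun k : nat => huygens_coef k * x ^ (2 * k + 1)) (phi x)) /\
  (forall c : R, 0 < c < PI / 2 -> forall x : R, 0 < x < c ->
     (forall n : nat, taylor1 phi n x - x <= taylor1 phi (S n) x - x) /\
     (forall n : nat, taylor1 phi n x - x < taylor1 phi (S n) x - x <->
        Nat.Odd (S n) /\ S n <> 3%nat) /\
     (forall n : nat, taylor1 phi n x - x < 2 / 3 * sin x + 1 / 3 * tan x - x) /\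
     (forall n : nat, 2 / 3 * sin x + 1 / 3 * tan x - x < taylor2 phi c n x - x) /\
     (forall n : nat, taylor2 phi c (S n) x - x < taylor2 phi c n x - x)).
Proof.
split.
{ intros x Hx. rewrite Hphi by exact Hx. now apply is_series_huygens_coef. }
intros c Hc x Hx.
assert (Hx' : 0 < x < PI / 2) by lra.
assert (Hpow : forall n, 0 < x ^ n) by (intros n; apply pow_lt; lra).
assert (Hstep : forall n,
  taylor1 phi (S n) x = taylor1 phi n x + phi_coef (S n) * x ^ S n).
{ intros n. rewrite !(taylor1_phi phi Hphi). reflexivity. }
assert (Hpos := tail_pos _ _ phi_coef_ge_0 phi_coef_infinitely_pos ex_pseries_phi).
rewrite <- Hphi, (phi_PSeries phi Hphi) by exact Hx'.
split; [|split; [|split; [|split]]]; intros n.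
- rewrite Hstep. pose proof (phi_coef_ge_0 (S n)). specialize (Hpow (S n)). nra.
- rewrite Hstep. specialize (Hpow (S n)). split.
  + intros Hlt. split.
    * destruct (Nat.Even_or_Odd (S n)) as [He|Ho]; [|exact Ho].
      rewrite phi_coef_even in Hlt by exact He. lra.
    * intros H3. rewrite H3, phi_coef_3 in Hlt. lra.
  + intros [Ho H3]. pose proof (phi_coef_pos _ Ho H3). nra.
- rewrite (taylor1_phi phi Hphi).
  rewrite (PSeries_partial_sum_tail _ _ ex_pseries_phi n x Hx').
  pose proof (Rmult_lt_0_compat _ _ (Hpow (S n)) (Hpos (S n) x Hx')). lra.
- rewrite (taylor2_phi_tail phi Hphi c x n Hc Hx').
  pose proof (tail_lt _ _ phi_coef_ge_0 phi_coef_infinitely_pos ex_pseries_phi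
    n x c Hx (proj2 Hc)) as Hlt.
  specialize (Hpow n). nra.
- rewrite !(taylor2_phi_tail phi Hphi c x _ Hc Hx').
  rewrite (tail_S _ _ ex_pseries_phi n c Hc), (tail_S _ _ ex_pseries_phi n x Hx').
  (* The difference of the two sides, by [tail_S] at [c] and at [x]. *)
  assert (H : 0 < x ^ n * ((c - x) * tail phi_coef (S n) c)).
  { apply Rmult_lt_0_compat; [apply Hpow|].
    apply Rmult_lt_0_compat; [lra|]. now apply Hpos. }
  rewrite <- tech_pow_Rmult. nra.
Qed.
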